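(* Let $\{(\hat p_h^k,\hat{\mathbf u}_h^k,\xi_h^k,\eta_h^{k+1})\}_{k=1}^N$ be a solution of Scheme-R with $\eta_h^k>0$ on $\Sigma$ for all $k=0,\dots,N+1$. Then for all $m=1,\dots,N$, $$E_h^m+\tau\sum_{k=1}^m\Big(2\mu\int_{\hat\Omega}\eta_h^k\big|(\nabla\hat{\mathbf u}_h^k(\mathbb F_h^k)^{-1})^{\rm S}\big|^2d\hat x+\gamma_3\|\partial_{x_1}\xi_h^k\|_{L^2(\Sigma)}^2+D^k_{num}\Big)=E_h^0,$$ where for $k=0,\dots,N$ $$E_h^k=\frac{\varrho_f}{2}\int_{\hat\Omega}\eta_h^k|\hat{\mathbf u}_h^k|^2d\hat x+\frac{\varrho_s}{2}\|\xi_h^k\|_{L^2(\Sigma)}^2+\frac{\gamma_1}{2}\|\partial_{x_1}\eta_h^{k+1}\|_{L^2(\Sigma)}^2+\frac{\gamma_2}{2}\|\partial^2_{x,h}\eta_h^{k+1}\|_{L^2(\Sigma)}^2,$$ $$D^k_{num}=\frac{\varrho_f\tau}{2}\int_{\hat\Omega}\eta_h^{k-1}|D_t\hat{\mathbf u}_h^k|^2d\hat x+\frac{\varrho_s\tau}{2}\|D_t\xi_h^k\|_{L^2(\Sigma)}^2+\frac{\gamma_1\tau}{2}\|\partial_{x_1}\xi_h^k\|_{L^2(\Sigma)}^2+\frac{\gamma_2\tau}{2}\|\partial^2_{x,h}\xi_h^k\|_{L^2(\Sigma)}^2\ \ (\ge0).$$ (Equivalently, with $\mathbf u_h^k=\hat{\mathbf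 u}_h^k\circ\mathcal A_{\eta_h^k}^{-1}$ on $\Omega_{\eta_h^k}$: $\int_{\hat\Omega}\eta_h^k|\hat{\mathbf u}_h^k|^2=\|\mathbf u_h^k\|^2_{L^2(\Omega_{\eta_h^k})}$ and $\int_{\hat\Omega}\eta_h^k|(\nabla\hat{\mathbf u}_h^k(\mathbb F_h^k)^{-1})^{\rm S}|^2=\|(\nabla\mathbf u_h^k)^{\rm S}\|^2_{L^2(\Omega_{\eta_h^k})}$.)
   Context: Setting: $\Sigma=(0,L_1)$, all functions $L_1$-periodic in the first variable; $\hat\Omega=\Sigma\times(0,1)$, $\Gamma_D=\Sigma\times\{0\}$; $\Omega_\eta=\{(x_1,x_2):x_1\in\Sigma,0<x_2<\eta(x_1)\}$, $\mathcal A_\eta(\hat x)=(\hat x_1,\eta\hat x_2)$; $\mathbb F(\eta)=\begin{pmatrix}1&0\\ \hat x_2\partial_{x_1}\eta&\eta\end{pmatrix}$, $\mathbb M(\eta)=\eta\mathbb F(\eta)^{-T}=\begin{pmatrix}\eta&-\hat x_2\partial_{x_1}\eta\\0&1\end{pmatrix}$; $(\nabla\mathbf u)_{ij}=\partial_ju_i$, $\mathbb A^{\rm S}=\frac12(\mathbb A+\mathbb A^T)$. Discrete spaces: $\mathcal T_h$ a shape-regular, quasi-uniform, periodic-compatible triangulation of $\hat\Omega$ of mesh size $h$, $\Sigma_h$ its trace partition on $\Sigma\times\{1\}$. $\hat V^f_h$: continuous, periodic $\mathbb R^2$-valued functions vanishing on $\Gamma_D$ whose components on each $K\in\mathcal T_h$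 lie in $\mathcal P^1(K)\oplus{\rm span}\{b_K\}$, $b_K$ the cubic bubble of $K$ (MINI element). $\hat Q^f_h$: continuous periodic piecewise affine functions on $\mathcal T_h$. $V^s_h$: continuous periodic piecewise affine functions on $\Sigma_h$. Discrete Laplacian $\partial^2_{x,h}:V^s_h\to V^s_h$: $\int_\Sigma\partial^2_{x,h}\eta\,\psi=-\int_\Sigma\partial_{x_1}\eta\,\partial_{x_1}\psi$ for all $\psi\in V^s_h$. $D_tv^k=(v^k-v^{k-1})/\tau$. $a_s(\eta,\zeta,\xi,\psi)=\int_\Sigma(\gamma_1\partial_{x_1}\eta\partial_{x_1}\psi+\gamma_2\partial_{x_1}\zeta\partial_{x_1}\psi+\gamma_3\partial_{x_1}\xi\partial_{x_1}\psi)$, constants $\varrho_f,\varrho_s,\mu,\gamma_1,\gamma_2>0,\gamma_3\ge0$. Scheme-R: given $\hat{\mathbf u}_h^0\in\hat V^f_h$, $\xi_h^0,\eta_h^0\in V^s_h$, set $\eta_h^1=\eta_h^0+\tau\xi_h^0$. For $k=1,\dots,N$ find $\hat p_h^k\in\hat Q^f_h$, $\hat{\mathbf u}_h^k\in\hat V^f_h$, $\xi_h^k,\eta_h^{k+1}\in V^s_h$ with $\hat{\mathbf u}_h^k(\hat x_1,1)=(0,\xi_h^k(\hat x_1))$, $\xi_h^k=D_t\eta_h^{k+1}$, such that for all $\hat q\in\hat Q^f_h$ and all $(\hat{\boldsymbol\varphi},\psi)\in\hat V^f_h\times V^s_h$ with $\hat{\boldsymbol\varphi}(\hat x_1,1)=(0,\psi(\hat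 x_1))$: (R1) $\int_{\hat\Omega}\hat q\,\nabla\hat{\mathbf u}_h^k:\mathbb M(\eta_h^k)=0$; (R2) $\varrho_f\int_{\hat\Omega}D_t\hat{\mathbf u}_h^k\cdot\hat{\boldsymbol\varphi}\,\eta_h^k+\frac12\varrho_f\int_{\hat\Omega}D_t\eta_h^k\,\hat{\mathbf u}_h^{k*}\cdot\hat{\boldsymbol\varphi}+\frac12\varrho_f\int_{\hat\Omega}\big(\hat{\boldsymbol\varphi}\cdot(\nabla\hat{\mathbf u}_h^k(\mathbb F_h^k)^{-1}\hat{\mathbf v}_h^{k-1})-\hat{\mathbf u}_h^k\cdot(\nabla\hat{\boldsymbol\varphi}(\mathbb F_h^k)^{-1}\hat{\mathbf v}_h^{k-1})\big)\eta_h^k+\int_{\hat\Omega}\hat{\boldsymbol\tau}_h^k:(\nabla\hat{\boldsymbol\varphi}(\mathbb F_h^k)^{-1})\eta_h^k+\varrho_s\int_\Sigma D_t\xi_h^k\psi+a_s(\eta_h^{k+1},\zeta_h^{k+1},\xi_h^k,\psi)=0$, where $\mathbb F_h^k=\mathbb F(\eta_h^k)$, $\hat{\mathbf u}_h^{k*}=2\hat{\mathbf u}_h^{k-1}-\hat{\mathbf u}_h^k$, $\hat{\mathbf w}_h^k=(0,\hat x_2D_t\eta_h^k)$, $\hat{\mathbf v}_h^{k-1}=\hat{\mathbf u}_h^{k-1}-\hat{\mathbf w}_h^k$, $\hat{\boldsymbol\tau}_h^k=2\mu(\nabla\hat{\mathbf u}_h^k(\mathbb F_h^k)^{-1})^{\rm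 S}-\hat p_h^k\mathbb I$, $\zeta_h^{k+1}=-\partial^2_{x,h}\eta_h^{k+1}$. *)

(* Defs.v *)
From Stdlib Require Import Reals List.
From Coquelicot Require Import Coquelicot.
Open Scope R_scope.

Definition pt := (R * R)%type.
Definition vadd (a b : pt) : pt := (fst a + fst b, snd a + snd b).
Definition vsub (a b : pt) : pt := (fst a - fst b, snd a - snd b).
Definition vscal (c : R) (a : pt) : pt := (c * fst a, c * snd a).
Definition dot (a b : pt) : R := fst a * fst b + snd a * snd b.

Record mat2 := M2 { m11 : R; m12 : R; m21 : R; m22 : R }.
Definition mI : mat2 := M2 1 0 0 1.
Definition madd (A B : mat2) : mat2 :=
  M2 (m11 A + m11 B) (m12 A + m12 B) (m21 A + m21 B) (m22 A + m22 B).
Definition mscal (c : R) (A : mat2) : mat2 :=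
  M2 (c * m11 A) (c * m12 A) (c * m21 A) (c * m22 A).
Definition msub (A B : mat2) : mat2 := madd A (mscal (-1) B).
Definition mtr (A : mat2) : mat2 := M2 (m11 A) (m21 A) (m12 A) (m22 A).
Definition mmul (A B : mat2) : mat2 :=
  M2 (m11 A * m11 B + m12 A * m21 B) (m11 A * m12 B + m12 A * m22 B)
     (m21 A * m11 B + m22 A * m21 B) (m21 A * m12 B + m22 A * m22 B).
Definition mdet (A : mat2) : R := m11 A * m22 A - m12 A * m21 A.
Definition minv (A : mat2) : mat2 :=
  mscal (/ mdet A) (M2 (m22 A) (- m12 A) (- m21 A) (m11 A)).
Definition msym (A : mat2) : mat2 := mscal (/2) (madd A (mtr A)).
Definition frob (A B : mat2) : R :=
  m11 A * m11 B + m12 A * m12 B + m21 A * m21 B + m22 A * m22 B.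
Definition mv (A : mat2) (v : pt) : pt :=
  (m11 A * fst v + m12 A * snd v, m21 A * fst v + m22 A * snd v).

Definition d1 (f : pt -> R) (x : pt) : R := Derive (fun t => f (t, snd x)) (fst x).
Definition d2 (f : pt -> R) (x : pt) : R := Derive (fun t => f (fst x, t)) (snd x).
Definition grad (u : pt -> pt) (x : pt) : mat2 :=
  M2 (d1 (fun y => fst (u y)) x) (d2 (fun y => fst (u y)) x)
     (d1 (fun y => snd (u y)) x) (d2 (fun y => snd (u y)) x).

Definition Fmat (eta : R -> R) (x : pt) : mat2 :=
  M2 1 0 (snd x * Derive eta (fst x)) (eta (fst x)).
Definition Mmat (eta : R -> R) (x : pt) : mat2 :=
  M2 (eta (fst x)) (- (snd x * Derive eta (fst x))) 0 1.

Definition intS (L1 : R) (f : R -> R) : R := RInt f 0 L1.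
Definition intO (L1 : R) (f : pt -> R) : R :=
  RInt (fun x1 => RInt (fun x2 => f (x1, x2)) 0 1) 0 L1.

Definition tri := (pt * pt * pt)%type.
Definition cross (a b c : pt) : R :=
  (fst b - fst a) * (snd c - snd a) - (snd b - snd a) * (fst c - fst a).
Definition in_tri (K : tri) (x : pt) : Prop :=
  let '(a, b, c) := K in
  exists l1 l2 l3, 0 <= l1 /\ 0 <= l2 /\ 0 <= l3 /\ l1 + l2 + l3 = 1 /\
    fst x = l1 * fst a + l2 * fst b + l3 * fst c /\
    snd x = l1 * snd a + l2 * snd b + l3 * snd c.
Definition in_tri_int (K : tri) (x : pt) : Prop :=
  let '(a, b, c) := K in
  exists l1 l2 l3, 0 < l1 /\ 0 < l2 /\ 0 < l3 /\ l1 + l2 + l3 = 1 /\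
    fst x = l1 * fst a + l2 * fst b + l3 * fst c /\
    snd x = l1 * snd a + l2 * snd b + l3 * snd c.
Definition vertex (K : tri) (v : pt) : Prop :=
  let '(a, b, c) := K in v = a \/ v = b \/ v = c.
Definition nondeg (K : tri) : Prop := let '(a, b, c) := K in cross a b c <> 0.
(* cubic bubble of K: product of the three affine functions vanishing on the edges *)
Definition bubble (K : tri) (x : pt) : R :=
  let '(a, b, c) := K in cross b c x * cross c a x * cross a b x.
Definition in_rect (L1 : R) (x : pt) : Prop :=
  0 <= fst x <= L1 /\ 0 <= snd x <= 1.

(* conforming, periodic-compatible triangulation of the closure of Omega_hat *)
Definition triangulation (L1 : R) (T : list tri) : Prop :=
  NoDup T /\
  (forall K, In K T -> nondeg K /\ (forall x, in_tri K x -> in_rect L1 x)) /\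
  (forall x, in_rect L1 x -> exists K, In K T /\ in_tri K x) /\
  (forall K K', In K T -> In K' T -> K <> K' ->
     (forall x, ~ (in_tri_int K x /\ in_tri_int K' x)) /\
     (forall v, vertex K v -> in_tri K' v -> vertex K' v)) /\
  (forall x2, (exists K, In K T /\ vertex K (0, x2)) <->
              (exists K, In K T /\ vertex K (L1, x2))).

Definition Vf (L1 : R) (T : list tri) (u : pt -> pt) : Prop :=
  (forall x1 x2, u (x1 + L1, x2) = u (x1, x2)) /\
  (forall x1, u (x1, 0) = (0, 0)) /\
  (forall K, In K T -> exists a1 b1 c1 e1 a2 b2 c2 e2, forall x, in_tri K x ->
     u x = (a1 + b1 * fst x + c1 * snd x + e1 * bubble K x,
            a2 + b2 * fst x + c2 * snd x + e2 * bubble K x)).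
Definition Qf (L1 : R) (T : list tri) (q : pt -> R) : Prop :=
  (forall x1 x2, q (x1 + L1, x2) = q (x1, x2)) /\
  (forall K, In K T -> exists a b c, forall x, in_tri K x ->
     q x = a + b * fst x + c * snd x).
(* P1 structure space V^s_h on the trace partition Sigma_h of T on Sigma x {1} *)
Definition Vs (L1 : R) (T : list tri) (g : R -> R) : Prop :=
  (forall t, g (t + L1) = g t) /\
  (forall K, In K T -> forall a b, vertex K (a, 1) -> vertex K (b, 1) -> a < b ->
     exists c d, forall t, a <= t <= b -> g t = c + d * t).

Definition is_dlap (L1 : R) (T : list tri) (lap : (R -> R) -> (R -> R)) : Prop :=
  forall eta, Vs L1 T eta ->
    Vs L1 T (lap eta) /\
    forall psi, Vs L1 T psi ->
      intS L1 (fun t => lap eta t * psi t) =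
      - intS L1 (fun t => Derive eta t * Derive psi t).

Definition a_s (L1 g1 g2 g3 : R) (eta zeta xi psi : R -> R) : R :=
  intS L1 (fun t => g1 * Derive eta t * Derive psi t + g2 * Derive zeta t * Derive psi t
                    + g3 * Derive xi t * Derive psi t).

Definition Gk (eta : nat -> R -> R) (u : nat -> pt -> pt) (k : nat) (x : pt) : mat2 :=
  mmul (grad (u k) x) (minv (Fmat (eta k) x)).

Definition R1_eq (L1 : R) (T : list tri) (eta : nat -> R -> R) (u : nat -> pt -> pt)
  (k : nat) : Prop :=
  forall q, Qf L1 T q ->
    intO L1 (fun x => q x * frob (grad (u k) x) (Mmat (eta k) x)) = 0.

Definition R2_lhs (L1 tau rf rs mu g1 g2 g3 : R) (lap : (R -> R) -> (R -> R))
  (p : nat -> pt -> R) (u : nat -> pt -> pt) (xi eta : nat -> R -> R) (k : nat)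
  (phi : pt -> pt) (psi : R -> R) : R :=
  let ek := eta k in
  let dteta := fun t => (eta k t - eta (k - 1)%nat t) / tau in
  let Finv := fun x => minv (Fmat ek x) in
  let ustar := fun x => vsub (vscal 2 (u (k - 1)%nat x)) (u k x) in
  let w := fun x => (0, snd x * dteta (fst x)) in
  let v := fun x => vsub (u (k - 1)%nat x) (w x) in
  let G := Gk eta u k in
  let tauh := fun x => msub (mscal (2 * mu) (msym (G x))) (mscal (p k x) mI) in
  let zeta := fun t => - lap (eta (k + 1)%nat) t in
  rf * intO L1 (fun x => dot (vscal (/ tau) (vsub (u k x) (u (k - 1)%nat x))) (phi x) * ek (fst x))
  + / 2 * rf * intO L1 (fun x => dteta (fst x) * dot (ustar x) (phi x))
  + / 2 * rf * intO L1 (fun x =>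
       (dot (phi x) (mv (G x) (v x))
        - dot (u k x) (mv (mmul (grad phi x) (Finv x)) (v x))) * ek (fst x))
  + intO L1 (fun x => frob (tauh x) (mmul (grad phi x) (Finv x)) * ek (fst x))
  + rs * intS L1 (fun t => (xi k t - xi (k - 1)%nat t) / tau * psi t)
  + a_s L1 g1 g2 g3 (eta (k + 1)%nat) zeta (xi k) psi.

Definition SchemeR_solution (L1 : R) (T : list tri) (tau rf rs mu g1 g2 g3 : R)
  (lap : (R -> R) -> (R -> R)) (N : nat)
  (p : nat -> pt -> R) (u : nat -> pt -> pt) (xi eta : nat -> R -> R) : Prop :=
  Vf L1 T (u 0%nat) /\ Vs L1 T (xi 0%nat) /\ Vs L1 T (eta 0%nat) /\
  (forall t, eta 1%nat t = eta 0%nat t + tau * xi 0%nat t) /\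
  (forall k, (1 <= k <= N)%nat ->
     Qf L1 T (p k) /\ Vf L1 T (u k) /\ Vs L1 T (xi k) /\ Vs L1 T (eta (k + 1)%nat) /\
     (forall t, u k (t, 1) = (0, xi k t)) /\
     (forall t, xi k t = (eta (k + 1)%nat t - eta k t) / tau) /\
     R1_eq L1 T eta u k /\
     (forall phi psi, Vf L1 T phi -> Vs L1 T psi -> (forall t, phi (t, 1) = (0, psi t)) ->
        R2_lhs L1 tau rf rs mu g1 g2 g3 lap p u xi eta k phi psi = 0)).

Definition Energy (L1 rf rs g1 g2 : R) (lap : (R -> R) -> (R -> R))
  (u : nat -> pt -> pt) (xi eta : nat -> R -> R) (k : nat) : R :=
  rf / 2 * intO L1 (fun x => eta k (fst x) * dot (u k x) (u k x))
  + rs / 2 * intS L1 (fun t => (xi k t) ^ 2)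
  + g1 / 2 * intS L1 (fun t => (Derive (eta (k + 1)%nat) t) ^ 2)
  + g2 / 2 * intS L1 (fun t => (lap (eta (k + 1)%nat) t) ^ 2).

Definition Dnum (L1 tau rf rs g1 g2 : R) (lap : (R -> R) -> (R -> R))
  (u : nat -> pt -> pt) (xi eta : nat -> R -> R) (k : nat) : R :=
  let Dtu := fun x => vscal (/ tau) (vsub (u k x) (u (k - 1)%nat x)) in
  rf * tau / 2 * intO L1 (fun x => eta (k - 1)%nat (fst x) * dot (Dtu x) (Dtu x))
  + rs * tau / 2 * intS L1 (fun t => ((xi k t - xi (k - 1)%nat t) / tau) ^ 2)
  + g1 * tau / 2 * intS L1 (fun t => (Derive (xi k) t) ^ 2)
  + g2 * tau / 2 * intS L1 (fun t => (lap (xi k) t) ^ 2).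

Fixpoint sumR (f : nat -> R) (n : nat) : R :=
  match n with O => 0 | S m => sumR f m + f (S m) end.

(* Main.v *)
Require Import Defs.
From Stdlib Require Import Reals List Lra Lia Classical.
From Coquelicot Require Import Coquelicot.
Import ListNotations.
Open Scope R_scope.

(** Test the momentum equation with [(u k, xi k)]. The convective term cancels, the pressure
    drops out by the divergence constraint tested with [p k], since
    [eta * tr (grad u F^-1) = grad u : M], and the remaining terms are discrete time
    derivatives of squares up to the numerical dissipation; in particular
    [(u1 - u0).u1 e1 + (e1 - e0) (2 u0 - u1).u1 / 2
       = (e1 |u1|^2 - e0 |u0|^2 + e0 |u1 - u0|^2) / 2].

    These pointwise identities pass to the iterated Riemann integrals once all integrands are
    known to be integrable. Over a vertical strip free of mesh vertices each integrand is
    continuous off the finitely many lines carrying the mesh edges, so its integral in the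
    second variable is a continuous function of the first one. *)

(** * Continuity of real-valued maps and of parameter integrals *)

Lemma continuous_Rplus {U : UniformSpace} (f g : U -> R) (x : U) :
  continuous f x -> continuous g x -> continuous (fun y => f y + g y) x.
Proof. intros Hf Hg; exact (continuous_plus f g x Hf Hg). Qed.

Lemma continuous_Rmult {U : UniformSpace} (f g : U -> R) (x : U) :
  continuous f x -> continuous g x -> continuous (fun y => f y * g y) x.
Proof. intros Hf Hg; exact (continuous_mult (K := R_AbsRing) f g x Hf Hg). Qed.

Lemma continuous_Ropp {U : UniformSpace} (f : U -> R) (x : U) :
  continuous f x -> continuous (fun y => - f y) x.
Proof. intros Hf; exact (continuous_opp f x Hf). Qed.

Lemma continuous_Rminus {U : UniformSpace} (f g : U -> R) (x : U) :
  continuous f x -> continuous g x -> continuous (fun y => f y - g y) x.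
Proof. intros Hf Hg; apply continuous_Rplus; [|apply continuous_Ropp]; assumption. Qed.

Lemma continuous_Rmax {U : UniformSpace} (f g : U -> R) (x : U) :
  continuous f x -> continuous g x -> continuous (fun y => Rmax (f y) (g y)) x.
Proof.
  intros Hf Hg.
  apply continuous_ext with (fun y => (f y + g y + Rabs (f y - g y)) * / 2).
  - intro y; unfold Rmax, Rabs; destruct (Rle_dec _ _), (Rcase_abs _); lra.
  - apply continuous_Rmult; [|apply continuous_const].
    apply continuous_Rplus; [apply continuous_Rplus; assumption|].
    apply (continuous_comp (fun y => f y - g y) Rabs);
      [apply continuous_Rminus; assumption | apply continuous_Rabs].
Qed.

Lemma continuous_Rmin {U : UniformSpace} (f g : U -> R) (x : U) :
  continuous f x -> continuous g x -> continuous (fun y => Rmin (f y) (g y)) x.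
Proof.
  intros Hf Hg.
  apply continuous_ext with (fun y => - Rmax (- f y) (- g y)).
  - intro y; unfold Rmax, Rmin; destruct (Rle_dec _ _), (Rle_dec _ _); lra.
  - apply continuous_Ropp, continuous_Rmax; apply continuous_Ropp; assumption.
Qed.

Lemma continuous_pair {U V W : UniformSpace} (f : U -> V) (g : U -> W) (x : U) :
  continuous f x -> continuous g x -> continuous (fun y => (f y, g y)) x.
Proof.
  intros Hf Hg. apply (continuous_comp_2 f g (fun a b => (a, b))); auto.
  apply continuous_ext with (fun z => z); [intros []; reflexivity | apply continuous_id].
Qed.

Lemma continuous_line (f : pt -> R) :
  (forall z : R * R, continuous f z) -> forall x y, continuous (fun s => f (x, s)) y.
Proof.
  intros Hf x y. apply (continuous_comp (fun s => (x, s)) f); [|apply Hf].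
  apply continuous_pair; [apply continuous_const | apply continuous_id].
Qed.

(** The second variable runs over the compact interval [[0,1]], so [h (x, s)] tends to [h (x0, s)]
    uniformly in [s] as [x] tends to [x0]. *)
Lemma continuous_RInt_param (h : pt -> R) :
  (forall z : R * R, continuous h z) ->
  forall x0, continuous (fun x => RInt (fun s => h (x, s)) 0 1) x0.
Proof.
  intros Hh x0.
  assert (Hex : forall x, ex_RInt (fun s => h (x, s)) 0 1).
  { intro x. apply (ex_RInt_continuous (V := R_CompleteNormedModule)).
    intros y _; apply continuous_line, Hh. }
  apply filterlim_locally; intros eps.
  destruct (uniform_continuity_2d_1d' (fun a b => h (a, b)) 0 1 x0) with
    (eps := mkposreal (eps / 2) (is_pos_div_2 eps)) as [del Hdel].
  { intros y _. apply continuity_2d_pt_filterlim.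
    apply (filterlim_ext h); [intros []; reflexivity|]. apply Hh. }
  exists del. intros x Hx.
  change (Rabs (RInt (fun s => h (x, s)) 0 1 - RInt (fun s => h (x0, s)) 0 1) < eps).
  change (Rabs (x - x0) < del) in Hx. apply Rabs_lt_between in Hx.
  rewrite <- (RInt_minus (V := R_CompleteNormedModule)) by apply Hex.
  (* The bound on the integral is only non-strict; halving [eps] restores the strict inequality. *)
  apply Rle_lt_trans with ((1 - 0) * (eps / 2)).
  - apply abs_RInt_le_const; [lra | |].
    + apply (ex_RInt_minus (V := R_NormedModule)); apply Hex.
    + intros t Ht. pose proof (cond_pos del).
      apply Rlt_le, (Hdel t x0 t x); try lra.
      rewrite Rminus_diag, Rabs_R0; assumption.
  - pose proof (cond_pos eps); lra.
Qed.

(** The substitution [y = (d x - c x) * s + c x] moves the variable bounds into the integrand and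
    fixes the interval to [[0,1]], whatever the order of [c x] and [d x]. *)
Lemma continuous_RInt_param_bounds (h : pt -> R) (c d : R -> R) :
  (forall z : R * R, continuous h z) ->
  (forall x, continuous c x) -> (forall x, continuous d x) ->
  forall x0, continuous (fun x => RInt (fun y => h (x, y)) (c x) (d x)) x0.
Proof.
  intros Hh Hc Hd x0.
  pose (g := fun z : pt => (d (fst z) - c (fst z)) *
               h (fst z, (d (fst z) - c (fst z)) * snd z + c (fst z))).
  assert (F1 : forall z : R * R, continuous fst z) by (intros []; apply continuous_fst).
  assert (F2 : forall z : R * R, continuous snd z) by (intros []; apply continuous_snd).
  assert (C1 : forall z : R * R, continuous (fun z : pt => c (fst z)) z)
    by (intro z; apply (continuous_comp fst c); auto).
  assert (D1 : forall z : R * R, continuous (fun z : pt => d (fst z)) z)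
    by (intro z; apply (continuous_comp fst d); auto).
  apply continuous_ext with (fun x => RInt (fun s => g (x, s)) 0 1).
  - intro x. unfold g; simpl.
    rewrite (RInt_comp_lin (V := R_CompleteNormedModule) (fun y => h (x, y))).
    + f_equal; simpl; ring.
    + apply (ex_RInt_continuous (V := R_CompleteNormedModule)).
      intros y _; apply continuous_line, Hh.
  - apply continuous_RInt_param. intro z. unfold g.
    apply continuous_Rmult; [apply continuous_Rminus; auto|].
    apply (continuous_comp (fun z : pt => (fst z, (d (fst z) - c (fst z)) * snd z + c (fst z))) h);
      [|apply Hh].
    apply continuous_pair; [apply F1|].
    apply continuous_Rplus; [apply continuous_Rmult; [apply continuous_Rminus|]|]; auto.
Qed.

(** * Piecewise continuous functions of two variables *)

(* The values on the separating graphs [snd z = c (fst z)] are left unconstrained. *)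
Inductive piecewise : (pt -> Prop) -> (pt -> R) -> Prop :=
| pw_cont (A : pt -> Prop) (f h : pt -> R) :
    (forall z : R * R, continuous h z) -> (forall z, A z -> f z = h z) -> piecewise A f
| pw_split (A : pt -> Prop) (f : pt -> R) (c : R -> R) :
    (forall x, continuous c x) ->
    piecewise (fun z => A z /\ snd z < c (fst z)) f ->
    piecewise (fun z => A z /\ c (fst z) < snd z) f ->
    piecewise A f.

Lemma piecewise_sub (A B : pt -> Prop) (f : pt -> R) :
  piecewise A f -> (forall z, B z -> A z) -> piecewise B f.
Proof.
  intro H; revert B; induction H as [A f h Hh Hf | A f c Hc H1 IH1 H2 IH2]; intros B HB.
  - apply pw_cont with h; auto.
  - apply pw_split with c; auto.
    + apply IH1; intros z []; auto.
    + apply IH2; intros z []; auto.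
Qed.

(** A common refinement: the cuts of [f] are made first, and those of [g] inside every resulting
    cell. *)
Lemma piecewise_map2 (op : R -> R -> R) (A : pt -> Prop) (f g : pt -> R) :
  (forall h k : pt -> R, (forall z : R * R, continuous h z) ->
     (forall z : R * R, continuous k z) ->
     forall z : R * R, continuous (fun w => op (h w) (k w)) z) ->
  piecewise A f -> piecewise A g -> piecewise A (fun z => op (f z) (g z)).
Proof.
  intros Hop Hf; revert g; induction Hf as [A f h Hh Hf | A f c Hc H1 IH1 H2 IH2]; intros g Hg.
  - induction Hg as [A g k Hk Hg | A g c Hc H1 IH1 H2 IH2].
    + apply pw_cont with (fun z => op (h z) (k z)); auto.
      intros z Hz; rewrite Hf, Hg; auto.
    + apply pw_split with c; auto.
      * apply IH1; intros z []; auto.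
      * apply IH2; intros z []; auto.
  - apply pw_split with c; auto.
    + apply IH1, piecewise_sub with (1 := Hg); intros z []; auto.
    + apply IH2, piecewise_sub with (1 := Hg); intros z []; auto.
Qed.

Lemma piecewise_plus A f g :
  piecewise A f -> piecewise A g -> piecewise A (fun z => f z + g z).
Proof. apply piecewise_map2; intros; apply continuous_Rplus; auto. Qed.

Lemma piecewise_mult A f g :
  piecewise A f -> piecewise A g -> piecewise A (fun z => f z * g z).
Proof. apply piecewise_map2; intros; apply continuous_Rmult; auto. Qed.

(* Cutting at [l] preserves continuity of the integral in [x] since
   [int_c^d f = int_(min c l)^(min d l) f + int_(max c l)^(max d l) f]. *)
Lemma piecewise_RInt (A : pt -> Prop) (f : pt -> R) :
  piecewise A f ->
  forall (a b : R) (c d : R -> R),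
  (forall x, continuous c x) -> (forall x, continuous d x) ->
  (forall x, a < x < b -> c x <= d x) ->
  (forall x y, a < x < b -> c x < y < d x -> A (x, y)) ->
  exists I : R -> R, (forall x, continuous I x) /\
    forall x, a < x < b -> is_RInt (fun y => f (x, y)) (c x) (d x) (I x).
Proof.
  induction 1 as [A f h Hh Hf | A f l Hl H1 IH1 H2 IH2]; intros a b c d Hc Hd Hcd HA.
  - exists (fun x => RInt (fun y => h (x, y)) (c x) (d x)). split.
    + apply continuous_RInt_param_bounds; auto.
    + intros x Hx. apply is_RInt_ext with (fun y => h (x, y)).
      * intros y. rewrite Rmin_left, Rmax_right by (apply Hcd; auto).
        intro Hy; symmetry; apply Hf, HA; auto.
      * apply (RInt_correct (V := R_CompleteNormedModule)), (ex_RInt_continuous (V := R_CompleteNormedModule)).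
        intros y _; apply continuous_line, Hh.
  - destruct (IH1 a b (fun x => Rmin (c x) (l x)) (fun x => Rmin (d x) (l x)))
      as [I1 [CI1 HI1]].
    { intro; apply continuous_Rmin; auto. }
    { intro; apply continuous_Rmin; auto. }
    { intros x Hx; specialize (Hcd x Hx); unfold Rmin; repeat destruct Rle_dec; lra. }
    { intros x y Hx Hy; specialize (HA x y Hx); simpl.
      split; [apply HA|]; revert Hy; unfold Rmin; repeat destruct Rle_dec; lra. }
    destruct (IH2 a b (fun x => Rmax (c x) (l x)) (fun x => Rmax (d x) (l x)))
      as [I2 [CI2 HI2]].
    { intro; apply continuous_Rmax; auto. }
    { intro; apply continuous_Rmax; auto. }
    { intros x Hx; specialize (Hcd x Hx); unfold Rmax; repeat destruct Rle_dec; lra. }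
    { intros x y Hx Hy; specialize (HA x y Hx); simpl.
      split; [apply HA|]; revert Hy; unfold Rmax; repeat destruct Rle_dec; lra. }
    exists (fun x => I1 x + I2 x); split.
    { intro; apply continuous_Rplus; auto. }
    intros x Hx; specialize (HI1 x Hx); specialize (HI2 x Hx); specialize (Hcd x Hx); simpl in *.
    (* Where [l] passes outside the interval, one of the two pieces shrinks to a point and
       contributes zero. *)
    assert (P : forall e v, is_RInt (fun y => f (x, y)) e e v -> v = 0).
    { intros e v Hv. rewrite <- (is_RInt_unique _ _ _ _ Hv).
      apply (RInt_point (V := R_CompleteNormedModule)). }
    destruct (Rle_dec (l x) (c x)) as [Hlc|Hlc]; [|destruct (Rle_dec (l x) (d x)) as [Hld|Hld]].
    + rewrite !Rmin_right in HI1 by lra. rewrite !Rmax_left in HI2 by lra.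
      rewrite (P _ _ HI1), Rplus_0_l; exact HI2.
    + rewrite Rmin_left, Rmin_right in HI1 by lra.
      rewrite Rmax_right, Rmax_left in HI2 by lra.
      exact (is_RInt_Chasles _ _ _ _ _ _ HI1 HI2).
    + rewrite !Rmin_left in HI1 by lra. rewrite !Rmax_right in HI2 by lra.
      rewrite (P _ _ HI2), Rplus_0_r; exact HI1.
Qed.

(** * Integration over vertical strips *)

(** With [V] the abscissae of the mesh vertices, no mesh edge ends in the interior of the strip. *)
Definition strip (L : R) (V : list R) (a b : R) : Prop :=
  0 <= a /\ a < b /\ b <= L /\ forall v, In v V -> ~ (a < v < b).

(** The representative [h] is continuous on the whole line, which yields integrability up to the
    ends of the strip. Values at the nodes stay free, as they must for [Derive] of a broken line. *)
Definition pw1 (L : R) (V : list R) (f : R -> R) : Prop :=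
  forall a b, strip L V a b ->
  exists h : R -> R, (forall t, continuous h t) /\ forall t, a < t < b -> f t = h t.

Definition pw2 (L : R) (V : list R) (f : pt -> R) : Prop :=
  forall a b, strip L V a b -> piecewise (fun z => a < fst z < b /\ 0 < snd z < 1) f.

(** Points of [V] are treated one at a time: an interval with [v] in its interior is cut at [v], and
    [Hadd] glues the halves together. *)
Lemma interval_split_ind (V : list R) (P : R -> R -> Prop) :
  (forall a b c, a < b < c -> P a b -> P b c -> P a c) ->
  forall a b, a < b ->
  (forall a' b', a <= a' -> a' < b' -> b' <= b ->
     (forall v, In v V -> ~ (a' < v < b')) -> P a' b') ->
  P a b.
Proof.
  intro Hadd; induction V as [|v V IH]; intros a b Hab H.
  - apply H; try lra. intros v [].
  - apply IH; auto. intros a' b' Ha Hab' Hb HV.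
    assert (K : forall a'' b'', a' <= a'' -> a'' < b'' -> b'' <= b' ->
              ~ (a'' < v < b'') -> P a'' b'').
    { intros a'' b'' H1 H2 H3 H4. apply H; try lra.
      intros w [<-|Hw]; auto. specialize (HV w Hw); lra. }
    destruct (classic (a' < v < b')) as [Hv|Hv].
    + apply Hadd with v; auto; apply K; lra.
    + apply K; auto; lra.
Qed.

Section Strips.
Variables (L : R) (V : list R).
Hypothesis L_pos : 0 < L.

Lemma strip_ind (P : R -> R -> Prop) :
  (forall a b c, a < b < c -> P a b -> P b c -> P a c) ->
  (forall a b, strip L V a b -> P a b) -> P 0 L.
Proof.
  intros Hadd H. apply (interval_split_ind V); auto.
  intros a b ? ? ? ?; apply H; repeat split; auto.
Qed.

Lemma ex_RInt_strip (f : R -> R) (a b : R) :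
  pw1 L V f -> strip L V a b -> ex_RInt f a b.
Proof.
  intros Hf Hs. destruct (Hf a b Hs) as [h [Hh E]].
  destruct Hs as [_ [Hab _]].
  apply ex_RInt_ext with h.
  - rewrite Rmin_left, Rmax_right by lra. intros x Hx; symmetry; auto.
  - apply (ex_RInt_continuous (V := R_CompleteNormedModule)); auto.
Qed.

Lemma pw1_ex_RInt (f : R -> R) : pw1 L V f -> ex_RInt f 0 L.
Proof.
  intro Hf. apply strip_ind.
  - intros a b c _; apply (ex_RInt_Chasles (V := R_NormedModule)).
  - intros a b; apply ex_RInt_strip; auto.
Qed.

(** The functions may differ at the finitely many nodes. The common value on each strip is carried
    along as a witness, so integrability of [f] is obtained together with the equality. *)
Lemma intS_ext (f g : R -> R) :
  pw1 L V g ->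
  (forall a b, strip L V a b -> forall t, a < t < b -> f t = g t) ->
  intS L f = intS L g.
Proof.
  intros Hg E.
  destruct (strip_ind (fun a b => exists v, is_RInt f a b v /\ is_RInt g a b v)) as [v [H1 H2]].
  - intros a b c _ [v [H1 H2]] [w [H3 H4]]. exists (plus v w).
    split; eapply is_RInt_Chasles; eauto.
  - intros a b Hs. destruct (ex_RInt_strip g a b Hg Hs) as [v Hv].
    exists v; split; auto. apply is_RInt_ext with g; auto.
    destruct Hs as [? [? ?]]. rewrite Rmin_left, Rmax_right by lra.
    intros x Hx; symmetry; apply (E a b); auto. repeat split; tauto.
  - unfold intS. rewrite (is_RInt_unique _ _ _ _ H1), (is_RInt_unique _ _ _ _ H2); reflexivity.
Qed.

Lemma intS_plus (f g : R -> R) :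
  pw1 L V f -> pw1 L V g -> intS L (fun t => f t + g t) = intS L f + intS L g.
Proof.
  intros Hf Hg. apply (RInt_plus (V := R_CompleteNormedModule)); apply pw1_ex_RInt; auto.
Qed.

Lemma intS_scal (c : R) (f : R -> R) :
  pw1 L V f -> intS L (fun t => c * f t) = c * intS L f.
Proof.
  intros Hf. apply (RInt_scal (V := R_CompleteNormedModule)), pw1_ex_RInt; auto.
Qed.

Lemma pw1_congr (f g : R -> R) :
  pw1 L V g -> (forall t, f t = g t) -> pw1 L V f.
Proof.
  intros Hg E a b Hs. destruct (Hg a b Hs) as [h [Hh Eh]].
  exists h; split; auto. intros; rewrite E; auto.
Qed.

Lemma pw1_const (c : R) : pw1 L V (fun _ => c).
Proof. intros a b _; exists (fun _ => c); split; auto. intro; apply continuous_const. Qed.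

Lemma pw1_plus (f g : R -> R) : pw1 L V f -> pw1 L V g -> pw1 L V (fun t => f t + g t).
Proof.
  intros Hf Hg a b Hs. destruct (Hf a b Hs) as [h [Hh E]], (Hg a b Hs) as [k [Hk F]].
  exists (fun t => h t + k t); split; [intro; apply continuous_Rplus; auto|].
  intros; rewrite E, F; auto.
Qed.

Lemma pw1_mult (f g : R -> R) : pw1 L V f -> pw1 L V g -> pw1 L V (fun t => f t * g t).
Proof.
  intros Hf Hg a b Hs. destruct (Hf a b Hs) as [h [Hh E]], (Hg a b Hs) as [k [Hk F]].
  exists (fun t => h t * k t); split; [intro; apply continuous_Rmult; auto|].
  intros; rewrite E, F; auto.
Qed.

Lemma pw2_fst (f : R -> R) : pw1 L V f -> pw2 L V (fun z => f (fst z)).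
Proof.
  intros Hf a b Hs. destruct (Hf a b Hs) as [h [Hh E]].
  apply pw_cont with (fun z => h (fst z)).
  - intros z. apply (continuous_comp fst h); auto. destruct z; apply continuous_fst.
  - intros z [Hz _]; auto.
Qed.

Lemma pw2_snd : pw2 L V snd.
Proof.
  intros a b _; apply pw_cont with snd; auto. intros []; apply continuous_snd.
Qed.

Lemma pw2_const (c : R) : pw2 L V (fun _ => c).
Proof. intros a b _; apply pw_cont with (fun _ => c); auto. intro; apply continuous_const. Qed.

Lemma pw2_plus (f g : pt -> R) : pw2 L V f -> pw2 L V g -> pw2 L V (fun z => f z + g z).
Proof. intros Hf Hg a b Hs; apply piecewise_plus; auto. Qed.

Lemma pw2_mult (f g : pt -> R) : pw2 L V f -> pw2 L V g -> pw2 L V (fun z => f z * g z).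
Proof. intros Hf Hg a b Hs; apply piecewise_mult; auto. Qed.

Lemma pw2_inner (f : pt -> R) (a b : R) :
  pw2 L V f -> strip L V a b ->
  exists I : R -> R, (forall x, continuous I x) /\
    forall x, a < x < b -> is_RInt (fun y => f (x, y)) 0 1 (I x).
Proof.
  intros Hf Hs.
  apply (piecewise_RInt _ _ (Hf a b Hs) a b (fun _ => 0) (fun _ => 1));
    try (intro; apply continuous_const).
  - intros; lra.
  - intros x y Hx Hy; simpl; auto.
Qed.

Lemma pw1_inner (f : pt -> R) :
  pw2 L V f -> pw1 L V (fun x => RInt (fun y => f (x, y)) 0 1).
Proof.
  intros Hf a b Hs. destruct (pw2_inner f a b Hf Hs) as [I [HI E]].
  exists I; split; auto. intros t Ht; apply is_RInt_unique; auto.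
Qed.

(** Equality on the whole open rectangle suffices for the energy identities: they are algebraic in
    the values of [Derive], whatever those are on mesh edges. *)
Lemma intO_ext (f g : pt -> R) :
  (forall x y, 0 < x < L -> 0 < y < 1 -> f (x, y) = g (x, y)) -> intO L f = intO L g.
Proof.
  intros E. apply RInt_ext; intros x. rewrite Rmin_left, Rmax_right by lra. intro Hx.
  apply RInt_ext; intros y. rewrite Rmin_left, Rmax_right by lra. auto.
Qed.

(** Slices are known to be integrable only at abscissae inside a strip, so the inner integral is
    split there and [intS_ext] ignores the remaining abscissae. *)
Lemma intO_plus (f g : pt -> R) :
  pw2 L V f -> pw2 L V g -> intO L (fun z => f z + g z) = intO L f + intO L g.
Proof.
  intros Hf Hg. change (intO L f) with (intS L (fun x => RInt (fun y => f (x, y)) 0 1)).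
  change (intO L g) with (intS L (fun x => RInt (fun y => g (x, y)) 0 1)).
  rewrite <- (intS_plus _ _ (pw1_inner f Hf) (pw1_inner g Hg)). apply intS_ext.
  - apply pw1_plus; apply pw1_inner; auto.
  - intros a b Hs t Ht.
    destruct (pw2_inner f a b Hf Hs) as [I [_ HI]], (pw2_inner g a b Hg Hs) as [J [_ HJ]].
    apply (RInt_plus (V := R_CompleteNormedModule)); eexists; eauto.
Qed.

Lemma intO_scal (c : R) (f : pt -> R) :
  pw2 L V f -> intO L (fun z => c * f z) = c * intO L f.
Proof.
  intros Hf. change (intO L f) with (intS L (fun x => RInt (fun y => f (x, y)) 0 1)).
  rewrite <- (intS_scal _ _ (pw1_inner f Hf)). apply intS_ext.
  - apply pw1_mult; [apply pw1_const | apply pw1_inner; auto].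
  - intros a b Hs t Ht. destruct (pw2_inner f a b Hf Hs) as [I [_ HI]].
    apply (RInt_scal (V := R_CompleteNormedModule)); eexists; eauto.
Qed.

End Strips.

(** * The mesh *)

Definition abscissae (T : list tri) : list R :=
  flat_map (fun K => let '(a, b, c) := K in [fst a; fst b; fst c]) T.

Definition edges (T : list tri) : list (pt * pt) :=
  flat_map (fun K => let '(a, b, c) := K in [(b, c); (c, a); (a, b)]) T.

(* For a vertical edge this is some affine function without geometric meaning. *)
Definition edge_line (e : pt * pt) (x : R) : R :=
  let '(p, q) := e in
  snd p + (snd q - snd p) / (fst q - fst p) * (x - fst p).

(** The interior of [K] through the numerators of its barycentric coordinates. The factor
    [cross a b c], twice the signed area, removes the dependence on orientation, and strict
    polynomial inequalities make openness immediate. *)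
Definition inside (K : tri) (z : pt) : Prop :=
  let '(a, b, c) := K in
  0 < cross b c z * cross a b c /\ 0 < cross c a z * cross a b c /\
  0 < cross a b z * cross a b c.

Ltac continuity :=
  cbv beta;
  lazymatch goal with
  | |- continuous (fun _ => ?c) _ => apply continuous_const
  | |- continuous (fun x => x) _ => apply continuous_id
  | |- continuous (fun x => fst x) ?z => destruct z; apply continuous_fst
  | |- continuous (fun x => snd x) ?z => destruct z; apply continuous_snd
  | |- continuous (fun x => @?f x + @?g x) _ => apply (continuous_Rplus f g); continuity
  | |- continuous (fun x => @?f x - @?g x) _ => apply (continuous_Rminus f g); continuity
  | |- continuous (fun x => @?f x * @?g x) _ => apply (continuous_Rmult f g); continuity
  end.

Lemma edge_line_continuous (e : pt * pt) (x : R) : continuous (edge_line e) x.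
Proof.
  destruct e as [p q]. unfold edge_line. continuity.
Qed.

(** For a vertical edge the sign of [cross p q] tells only on which side of the edge the strip lies.
    Otherwise [cross p q z] is a fixed nonzero multiple of the height of [z] above the edge line. *)
Lemma cross_same_side (p q : pt) (a b : R) (z w : pt) :
  p <> q -> ~ (a < fst p < b) -> a < fst z < b -> a < fst w < b ->
  (snd z < edge_line (p, q) (fst z) /\ snd w < edge_line (p, q) (fst w)) \/
  (edge_line (p, q) (fst z) < snd z /\ edge_line (p, q) (fst w) < snd w) ->
  0 < cross p q z * cross p q w.
Proof.
  intros Hpq Hp Hz Hw H. destruct (Req_dec (fst q) (fst p)) as [E|E].
  - unfold cross. rewrite E.
    assert (Hs : snd q - snd p <> 0).
    { intro D; apply Hpq. destruct p, q; simpl in *; f_equal; lra. }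
    replace (_ * _) with ((snd q - snd p) ^ 2 * ((fst z - fst p) * (fst w - fst p))) by ring.
    apply Rmult_lt_0_compat.
    + apply pow2_gt_0; auto.
    + destruct (Rle_dec (fst p) a); nra.
  - assert (C : forall z, cross p q z = (fst q - fst p) * (snd z - edge_line (p, q) (fst z))).
    { intro; unfold cross, edge_line; field; lra. }
    rewrite !C.
    replace (_ * _) with ((fst q - fst p) ^ 2 *
       ((snd z - edge_line (p, q) (fst z)) * (snd w - edge_line (p, q) (fst w)))) by ring.
    apply Rmult_lt_0_compat.
    + apply pow2_gt_0; lra.
    + destruct H; nra.
Qed.

(** Cutting along the curves one after another leaves cells lying strictly on one side of each; the
    regions [B] stand for these cells. *)
Lemma piecewise_lines (E : list (R -> R)) (A : pt -> Prop) (f : pt -> R) :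
  (forall c, In c E -> forall x, continuous c x) ->
  (forall B : pt -> Prop, (forall z, B z -> A z) ->
     (forall c, In c E -> (forall z, B z -> snd z < c (fst z)) \/
                          (forall z, B z -> c (fst z) < snd z)) ->
     exists h : pt -> R, (forall z : R * R, continuous h z) /\ forall z, B z -> f z = h z) ->
  piecewise A f.
Proof.
  revert A; induction E as [|c E IH]; intros A Hc H.
  - destruct (H A) as [h [Hh Eh]]; auto.
    + intros c [].
    + apply pw_cont with h; auto.
  - apply pw_split with c.
    + apply Hc; left; auto.
    + apply IH; [intros; apply Hc; right; auto|].
      intros B HB Hs. apply H.
      * intros z Hz; apply HB; auto.
      * intros d [<-|Hd]; auto. left; intros z Hz; apply HB; auto.
    + apply IH; [intros; apply Hc; right; auto|].
      intros B HB Hs. apply H.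
      * intros z Hz; apply HB; auto.
      * intros d [<-|Hd]; auto. right; intros z Hz; apply HB; auto.
Qed.

(** The barycentric coordinates of [z] are the areas of the three subtriangles divided by that of
    [K]. *)
Lemma inside_in_tri (K : tri) (z : pt) : inside K z -> in_tri K z.
Proof.
  destruct K as [[a b] c]; simpl. intros [H1 [H2 H3]].
  assert (D : cross a b c <> 0) by (intro E; rewrite E in H1; lra).
  assert (P : forall r, 0 < r * cross a b c -> 0 <= r / cross a b c).
  { intros r Hr. replace (r / cross a b c) with (r * cross a b c * / (cross a b c) ^ 2)
      by (field; auto).
    apply Rlt_le, Rmult_lt_0_compat; auto.
    apply Rinv_0_lt_compat, pow2_gt_0; auto. }
  exists (cross b c z / cross a b c), (cross c a z / cross a b c), (cross a b z / cross a b c).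
  repeat split; auto; revert D; unfold cross; intro D; field; auto.
Qed.

Lemma locally_pos (g : R -> R) (t : R) :
  continuous g t -> 0 < g t -> locally t (fun s => 0 < g s).
Proof. intros Hg H. apply (Hg (fun y => 0 < y)), (open_gt 0), H. Qed.

(** Openness along a coordinate line allows a partial derivative inside [K] to be computed from the
    polynomial valid on [K]. *)
Lemma inside_locally_1 (K : tri) (x y : R) :
  inside K (x, y) -> locally x (fun t => inside K (t, y)).
Proof.
  destruct K as [[a b] c]; simpl. intros [H1 [H2 H3]].
  repeat apply filter_and;
    (apply locally_pos; [unfold cross; simpl; continuity | assumption]).
Qed.

Lemma inside_locally_2 (K : tri) (x y : R) :
  inside K (x, y) -> locally y (fun t => inside K (x, t)).
Proof.
  destruct K as [[a b] c]; simpl. intros [H1 [H2 H3]].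
  repeat apply filter_and;
    (apply locally_pos; [unfold cross; simpl; continuity | assumption]).
Qed.

(** Take a triangle covering [z0]. The region meets none of its edge lines, so each barycentric
    numerator keeps its strict sign from [z0] to every other point of the region. *)
Lemma one_sided_region_inside (L : R) (T : list tri) (a b : R) (B : pt -> Prop) (z0 : pt) :
  triangulation L T -> strip L (abscissae T) a b ->
  (forall z, B z -> a < fst z < b /\ 0 < snd z < 1) -> B z0 ->
  (forall e, In e (edges T) -> (forall z, B z -> snd z < edge_line e (fst z)) \/
                               (forall z, B z -> edge_line e (fst z) < snd z)) ->
  exists K, In K T /\ forall z, B z -> inside K z.
Proof.
  intros [_ [HK [Hcov _]]] [Ha [Hab [Hb HV]]] HB Hz0 Hside.
  destruct (Hcov z0) as [K [KT Kz0]].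
  { destruct (HB z0 Hz0); split; lra. }
  exists K; split; auto. intros z Hz.
  destruct (HK K KT) as [Hnd _].
  assert (He : forall e, In e (let '(a, b, c) := K in [(b, c); (c, a); (a, b)]) ->
               In e (edges T)).
  { intros e He; apply in_flat_map; exists K; auto. }
  assert (Hv : forall v, In v (let '(a, b, c) := K in [fst a; fst b; fst c]) ->
               ~ (a < v < b)).
  { intros v Hv; apply HV, in_flat_map; exists K; auto. }
  destruct K as [[k1 k2] k3]; simpl in *.
  destruct Kz0 as [l1 [l2 [l3 [P1 [P2 [P3 [S [X Y]]]]]]]].
  assert (G : forall p q l, In (p, q) [(k2, k3); (k3, k1); (k1, k2)] -> p <> q ->
     ~ (a < fst p < b) -> 0 <= l -> cross p q z0 = l * cross k1 k2 k3 ->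
     0 < cross p q z * cross k1 k2 k3).
  { intros p q l Hin Hpq Hp Hl Hc.
    assert (Q : forall w, B w -> 0 < cross p q z0 * cross p q w).
    { intros w Hw. apply cross_same_side with a b; auto; try (apply HB; auto).
      destruct (Hside (p, q) (He _ Hin)); auto. }
    pose proof (Q z Hz) as Q1. rewrite Hc in Q1.
    (* A vanishing coordinate would make [cross p q z0] zero, against the strict sign in [Q1]. *)
    destruct (Rle_lt_or_eq_dec 0 l Hl) as [Hl'|Hl']; [|subst l; lra].
    apply Rmult_lt_reg_l with l; auto. rewrite Rmult_0_r. lra. }
  assert (N : k1 <> k2 /\ k2 <> k3 /\ k3 <> k1).
  { repeat split; intro E; apply Hnd; rewrite E; unfold cross; ring. }
  destruct N as [N1 [N2 N3]].
  assert (l1 = 1 - l2 - l3) by lra. subst l1.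
  repeat split.
  - apply G with (1 - l2 - l3); simpl; auto; try (apply Hv; simpl; auto).
    unfold cross; rewrite X, Y; ring.
  - apply G with l2; simpl; auto; try (apply Hv; simpl; auto).
    unfold cross; rewrite X, Y; ring.
  - apply G with l3; simpl; auto; try (apply Hv; simpl; auto).
    unfold cross; rewrite X, Y; ring.
Qed.

Lemma pw2_elementwise (L : R) (T : list tri) (f : pt -> R) :
  triangulation L T ->
  (forall K, In K T -> exists h : pt -> R,
     (forall z : R * R, continuous h z) /\ forall z, inside K z -> f z = h z) ->
  pw2 L (abscissae T) f.
Proof.
  intros HT Hf a b Hs. apply piecewise_lines with (map edge_line (edges T)).
  - intros c Hc; apply in_map_iff in Hc; destruct Hc as [e [<- _]].
    apply edge_line_continuous.
  - intros B HB Hside.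
    destruct (classic (exists z0, B z0)) as [[z0 Hz0]|Hno].
    + destruct (one_sided_region_inside L T a b B z0) as [K [KT HK]]; auto.
      { intros e He; apply Hside, in_map, He. }
      destruct (Hf K KT) as [h [Hh E]]. exists h; split; auto.
    (* On an empty cell any continuous function serves. *)
    + exists (fun _ => 0); split; [intro; apply continuous_const|].
      intros z Hz; exfalso; apply Hno; exists z; auto.
Qed.

(** * Finite element functions on the mesh and their partial derivatives *)

Definition mini (T : list tri) (f : pt -> R) : Prop :=
  forall K, In K T -> exists a b c e, forall x, in_tri K x ->
    f x = a + b * fst x + c * snd x + e * bubble K x.

Lemma mini_pw2 (L : R) (T : list tri) (f : pt -> R) :
  triangulation L T -> mini T f -> pw2 L (abscissae T) f.
Proof.
  intros HT Hf. apply pw2_elementwise; auto. intros K KT.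
  destruct (Hf K KT) as [a [b [c [e E]]]].
  exists (fun x => a + b * fst x + c * snd x + e * bubble K x); split.
  - destruct K as [[k1 k2] k3]; unfold bubble, cross. intro z; continuity.
  - intros z Hz; apply E, inside_in_tri, Hz.
Qed.

Lemma mini_d1_pw2 (L : R) (T : list tri) (f : pt -> R) :
  triangulation L T -> mini T f -> pw2 L (abscissae T) (Defs.d1 f).
Proof.
  intros HT Hf. apply pw2_elementwise; auto. intros K KT.
  destruct (Hf K KT) as [a [b [c [e E]]]].
  destruct K as [[k1 k2] k3].
  (* Product rule for the bubble: [cross p q] has slope [snd p - snd q] in the first variable, hence
     the minus sign. *)
  exists (fun x => b - e * ((snd k3 - snd k2) * cross k3 k1 x * cross k1 k2 x
                      + cross k2 k3 x * (snd k1 - snd k3) * cross k1 k2 x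
                      + cross k2 k3 x * cross k3 k1 x * (snd k2 - snd k1))); split.
  - unfold cross; intro z; continuity.
  - intros [x y] Hz. unfold Defs.d1; simpl.
    rewrite (Derive_ext_loc _
      (fun t => a + b * t + c * y + e * bubble (k1, k2, k3) (t, y))).
    + apply is_derive_unique. unfold bubble, cross; simpl. auto_derive; auto; ring.
    + apply filter_imp with (2 := inside_locally_1 _ _ _ Hz).
      intros t Ht; apply (E (t, y)), inside_in_tri, Ht.
Qed.

Lemma mini_d2_pw2 (L : R) (T : list tri) (f : pt -> R) :
  triangulation L T -> mini T f -> pw2 L (abscissae T) (Defs.d2 f).
Proof.
  intros HT Hf. apply pw2_elementwise; auto. intros K KT.
  destruct (Hf K KT) as [a [b [c [e E]]]].
  destruct K as [[k1 k2] k3].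
  (* In the second variable [cross p q] has slope [fst q - fst p]. *)
  exists (fun x => c + e * ((fst k3 - fst k2) * cross k3 k1 x * cross k1 k2 x
                      + cross k2 k3 x * (fst k1 - fst k3) * cross k1 k2 x
                      + cross k2 k3 x * cross k3 k1 x * (fst k2 - fst k1))); split.
  - unfold cross; intro z; continuity.
  - intros [x y] Hz. unfold Defs.d2; simpl.
    rewrite (Derive_ext_loc _
      (fun t => a + b * x + c * t + e * bubble (k1, k2, k3) (x, t))).
    + apply is_derive_unique. unfold bubble, cross; simpl. auto_derive; auto; ring.
    + apply filter_imp with (2 := inside_locally_2 _ _ _ Hz).
      intros t Ht; apply (E (x, t)), inside_in_tri, Ht.
Qed.

Lemma Qf_mini (L : R) (T : list tri) (q : pt -> R) : Qf L T q -> mini T q.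
Proof.
  intros [_ H] K KT. destruct (H K KT) as [a [b [c E]]].
  exists a, b, c, 0. intros x Hx; rewrite E by auto; ring.
Qed.

Lemma Vf_mini (L : R) (T : list tri) (u : pt -> pt) :
  Vf L T u -> mini T (fun x => fst (u x)) /\ mini T (fun x => snd (u x)).
Proof.
  intros [_ [_ H]].
  split; intros K KT; destruct (H K KT) as [a1 [b1 [c1 [e1 [a2 [b2 [c2 [e2 E]]]]]]]].
  - exists a1, b1, c1, e1. intros x Hx; rewrite E; auto.
  - exists a2, b2, c2, e2. intros x Hx; rewrite E; auto.
Qed.

(** * Structure functions on the trace partition *)

(** If [p] and [q] were on the same side of the interval, so would be every convex combination of
    them. *)
Lemma bracket_of_convex (l1 l2 p q a b x : R) :
  0 <= l1 -> 0 <= l2 -> l1 + l2 = 1 -> x = l1 * p + l2 * q -> a < x < b ->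
  ~ (a < p < b) -> ~ (a < q < b) -> (p <= a /\ b <= q) \/ (q <= a /\ b <= p).
Proof.
  intros H1 H2 S X Hx Hp Hq.
  destruct (Rle_dec p a), (Rle_dec q a); [nra | left; lra | right; lra |].
  assert (b <= p) by lra. assert (b <= q) by lra. nra.
Qed.

(* The triangle covering the point of [Sigma x {1}] above the middle of the strip has an
   edge on [Sigma x {1}] spanning the strip, as all its vertices lie below that line. *)
Lemma Vs_affine_on_strip (L : R) (T : list tri) (g : R -> R) (a b : R) :
  triangulation L T -> Vs L T g -> strip L (abscissae T) a b ->
  exists c d, forall t, a <= t <= b -> g t = c + d * t.
Proof.
  intros [_ [HK [Hcov _]]] [_ Hg] [Ha [Hab [Hb HV]]].
  destruct (Hcov ((a + b) / 2, 1)) as [K [KT Kz]].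
  { split; simpl; lra. }
  destruct (HK K KT) as [Hnd Hrect].
  assert (Hv : forall v, vertex K v -> ~ (a < fst v < b) /\ snd v <= 1).
  { intros v Hv; split.
    - apply HV, in_flat_map; exists K; split; auto.
      destruct K as [[k1 k2] k3]; simpl in *.
      destruct Hv as [-> | [-> | ->]]; auto.
    - apply Hrect. destruct K as [[k1 k2] k3]; simpl in *.
      destruct Hv as [-> | [-> | ->]];
        [exists 1, 0, 0 | exists 0, 1, 0 | exists 0, 0, 1]; repeat split; lra. }
  assert (G : forall p q l1 l2, vertex K p -> vertex K q -> snd p = 1 -> snd q = 1 ->
     0 <= l1 -> 0 <= l2 -> l1 + l2 = 1 -> (a + b) / 2 = l1 * fst p + l2 * fst q ->
     exists c d, forall t, a <= t <= b -> g t = c + d * t).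
  { intros [p1 p2] [q1 q2] l1 l2 Hp Hq; simpl; intros -> -> P1 P2 S X.
    destruct (Hv _ Hp) as [Hp' _], (Hv _ Hq) as [Hq' _]; simpl in *.
    destruct (bracket_of_convex l1 l2 p1 q1 a b ((a + b) / 2)) as [[H1 H2]|[H1 H2]];
      auto; try lra.
    - destruct (Hg K KT p1 q1) as [c [d E]]; auto; [lra|].
      exists c, d; intros; apply E; lra.
    - destruct (Hg K KT q1 p1) as [c [d E]]; auto; [lra|].
      exists c, d; intros; apply E; lra. }
  destruct K as [[k1 k2] k3]; simpl in *.
  destruct Kz as [l1 [l2 [l3 [P1 [P2 [P3 [S [X Y]]]]]]]].
  destruct (Hv k1) as [V1 Y1], (Hv k2) as [V2 Y2], (Hv k3) as [V3 Y3]; auto.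
  (* The three products are nonnegative and add up to zero, since the covered point has height 1. *)
  assert (Z : l1 * (1 - snd k1) = 0 /\ l2 * (1 - snd k2) = 0 /\ l3 * (1 - snd k3) = 0) by nra.
  destruct Z as [Z1 [Z2 Z3]].
  apply Rmult_integral in Z1, Z2, Z3.
  (* A single contributing vertex would lie at the middle of the strip, and three vertices at height
     1 would make [K] degenerate. Exactly two remain, the ends of the sought edge. *)
  destruct Z1 as [Z1|Z1], Z2 as [Z2|Z2], Z3 as [Z3|Z3]; try lra.
  - exfalso; apply V3; subst l1 l2; replace l3 with 1 in X by lra; lra.
  - exfalso; apply V2; subst l1 l3; replace l2 with 1 in X by lra; lra.
  - apply (G k2 k3 l2 l3); auto; subst l1; lra.
  - exfalso; apply V1; subst l2 l3; replace l1 with 1 in X by lra; lra.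
  - apply (G k1 k3 l1 l3); auto; subst l2; lra.
  - apply (G k1 k2 l1 l2); auto; subst l3; lra.
  - exfalso; apply Hnd; unfold cross.
    replace (snd k1) with 1 by lra. replace (snd k2) with 1 by lra.
    replace (snd k3) with 1 by lra. ring.
Qed.

Lemma Vs_pw1 (L : R) (T : list tri) (g : R -> R) :
  triangulation L T -> Vs L T g -> pw1 L (abscissae T) g.
Proof.
  intros HT Hg a b Hs. destruct (Vs_affine_on_strip L T g a b HT Hg Hs) as [c [d E]].
  exists (fun t => c + d * t); split; [intro; continuity|]. intros; apply E; lra.
Qed.

Lemma Vs_is_derive (L : R) (T : list tri) (g : R -> R) (a b : R) :
  triangulation L T -> Vs L T g -> strip L (abscissae T) a b ->
  exists d, forall t, a < t < b -> is_derive g t d.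
Proof.
  intros HT Hg Hs. destruct (Vs_affine_on_strip L T g a b HT Hg Hs) as [c [d E]].
  exists d; intros t Ht. apply is_derive_ext_loc with (fun t => c + d * t).
  - apply (locally_interval _ t a b); simpl; try lra.
    intros y Hy1 Hy2; simpl in *; symmetry; apply E; lra.
  - auto_derive; auto; ring.
Qed.

Lemma Vs_Derive_pw1 (L : R) (T : list tri) (g : R -> R) :
  triangulation L T -> Vs L T g -> pw1 L (abscissae T) (Derive g).
Proof.
  intros HT Hg a b Hs. destruct (Vs_is_derive L T g a b HT Hg Hs) as [d E].
  exists (fun _ => d); split; [intro; apply continuous_const|].
  intros; apply is_derive_unique; auto.
Qed.

(** On the strip [g] is affine and hence at least [m], the smaller of its end values. Truncating the
    affine function below at [m] changes nothing there and makes its reciprocal continuous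
    everywhere. *)
Lemma Vs_inv_pw1 (L : R) (T : list tri) (g : R -> R) :
  triangulation L T -> Vs L T g -> (forall t, 0 <= t <= L -> 0 < g t) ->
  pw1 L (abscissae T) (fun t => / g t).
Proof.
  intros HT Hg Hpos a b Hs. destruct (Vs_affine_on_strip L T g a b HT Hg Hs) as [c [d E]].
  destruct Hs as [Ha [Hab [Hb _]]].
  pose (m := Rmin (g a) (g b)).
  assert (Hm : 0 < m) by (apply Rmin_glb_lt; apply Hpos; lra).
  exists (fun t => / Rmax (c + d * t) m); split.
  - intro t. apply continuous_Rinv_comp.
    + apply continuous_Rmax; continuity.
    + pose proof (Rmax_r (c + d * t) m); lra.
  - intros t Ht. rewrite E by lra. rewrite Rmax_left; auto.
    assert (m <= c + d * a) by (rewrite <- E by lra; apply Rmin_l).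
    assert (m <= c + d * b) by (rewrite <- E by lra; apply Rmin_r).
    destruct (Rle_dec 0 d); nra.
Qed.

(** * Integrability of the expressions occurring in the scheme *)

Lemma pw1_minus (L : R) (V : list R) (f g : R -> R) :
  pw1 L V f -> pw1 L V g -> pw1 L V (fun t => f t - g t).
Proof.
  intros Hf Hg. apply pw1_congr with (fun t => f t + -1 * g t); [|intro; ring].
  apply pw1_plus; auto. apply pw1_mult; auto. apply pw1_const.
Qed.

Lemma pw2_congr (L : R) (V : list R) (f g : pt -> R) :
  pw2 L V g -> (forall z, f z = g z) -> pw2 L V f.
Proof.
  intros Hg E a b Hs. specialize (Hg a b Hs).
  induction Hg as [A g h Hh Eh | A g c Hc H1 IH1 H2 IH2].
  - apply pw_cont with h; auto. intros; rewrite E; auto.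
  - apply pw_split with c; auto.
Qed.

Lemma pw2_minus (L : R) (V : list R) (f g : pt -> R) :
  pw2 L V f -> pw2 L V g -> pw2 L V (fun z => f z - g z).
Proof.
  intros Hf Hg. apply pw2_congr with (fun z => f z + -1 * g z); [|intro; ring].
  apply pw2_plus; auto. apply pw2_mult; auto. apply pw2_const.
Qed.

Ltac pw :=
  cbv beta;
  first [ assumption |
  lazymatch goal with
  | |- pw1 _ _ (fun _ => ?c) => apply pw1_const
  | |- pw1 _ _ (fun t => @?f t + @?g t) => apply (pw1_plus _ _ f g); pw
  | |- pw1 _ _ (fun t => @?f t - @?g t) => apply (pw1_minus _ _ f g); pw
  | |- pw1 _ _ (fun t => @?f t * @?g t) => apply (pw1_mult _ _ f g); pw
  | |- pw1 _ _ (fun t => @?f t / @?g t) => apply (pw1_mult _ _ f (fun t => / g t)); pw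
  | |- pw2 _ _ (fun _ => ?c) => apply pw2_const
  | |- pw2 _ _ (fun z => snd z) => apply pw2_snd
  | |- pw2 _ _ (fun z => @?f z + @?g z) => apply (pw2_plus _ _ f g); pw
  | |- pw2 _ _ (fun z => @?f z - @?g z) => apply (pw2_minus _ _ f g); pw
  | |- pw2 _ _ (fun z => @?f z * @?g z) => apply (pw2_mult _ _ f g); pw
  | |- pw2 _ _ (fun z => @?f z / @?g z) => apply (pw2_mult _ _ f (fun z => / g z)); pw
  | |- pw2 _ _ (fun z => ?f (fst z)) => apply (pw2_fst _ _ f); pw
  | |- pw2 _ _ (fun z => / ?f (fst z)) => apply (pw2_fst _ _ (fun t => / f t)); pw
  end ].

Definition pw2v (L : R) (V : list R) (w : pt -> pt) : Prop :=
  pw2 L V (fun z => fst (w z)) /\ pw2 L V (fun z => snd (w z)).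

Definition pw2m (L : R) (V : list R) (A : pt -> mat2) : Prop :=
  pw2 L V (fun z => m11 (A z)) /\ pw2 L V (fun z => m12 (A z)) /\
  pw2 L V (fun z => m21 (A z)) /\ pw2 L V (fun z => m22 (A z)).

Lemma pw2_dot (L : R) (V : list R) (v w : pt -> pt) :
  pw2v L V v -> pw2v L V w -> pw2 L V (fun z => dot (v z) (w z)).
Proof. intros [? ?] [? ?]; unfold dot; pw. Qed.

Lemma pw2v_vsub (L : R) (V : list R) (v w : pt -> pt) :
  pw2v L V v -> pw2v L V w -> pw2v L V (fun z => vsub (v z) (w z)).
Proof. intros [? ?] [? ?]; split; simpl; pw. Qed.

Lemma pw2v_vscal (L : R) (V : list R) (c : R) (w : pt -> pt) :
  pw2v L V w -> pw2v L V (fun z => vscal c (w z)).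
Proof. intros [? ?]; split; simpl; pw. Qed.

Lemma pw2_frob (L : R) (V : list R) (A B : pt -> mat2) :
  pw2m L V A -> pw2m L V B -> pw2 L V (fun z => frob (A z) (B z)).
Proof. intros [? [? [? ?]]] [? [? [? ?]]]; unfold frob; pw. Qed.

Lemma pw2m_msym (L : R) (V : list R) (A : pt -> mat2) :
  pw2m L V A -> pw2m L V (fun z => msym (A z)).
Proof. intros [? [? [? ?]]]; repeat split; simpl; pw. Qed.

Lemma pw2v_Vf (L : R) (T : list tri) (w : pt -> pt) :
  triangulation L T -> Vf L T w -> pw2v L (abscissae T) w.
Proof.
  intros HT Hw; destruct (Vf_mini L T w Hw); split; apply mini_pw2; auto.
Qed.

Lemma pw2m_grad (L : R) (T : list tri) (w : pt -> pt) :
  triangulation L T -> Vf L T w -> pw2m L (abscissae T) (grad w).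
Proof.
  intros HT Hw; destruct (Vf_mini L T w Hw); repeat split; simpl;
    (apply mini_d1_pw2 || apply mini_d2_pw2); auto.
Qed.

Lemma pw2m_Mmat (L : R) (T : list tri) (e : R -> R) :
  triangulation L T -> Vs L T e -> pw2m L (abscissae T) (Mmat e).
Proof.
  intros HT He. pose proof (Vs_pw1 L T e HT He). pose proof (Vs_Derive_pw1 L T e HT He).
  repeat split; simpl; try pw.
  apply pw2_congr with (fun z => -1 * (snd z * Derive e (fst z))); [pw | intro; ring].
Qed.

Lemma pw2m_mul_minv_Fmat (L : R) (T : list tri) (e : R -> R) (A : pt -> mat2) :
  triangulation L T -> Vs L T e -> (forall t, 0 <= t <= L -> 0 < e t) ->
  pw2m L (abscissae T) A ->
  pw2m L (abscissae T) (fun z => mmul (A z) (minv (Fmat e z))).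
Proof.
  intros HT He Hpos [H11 [H12 [H21 H22]]].
  pose proof (Vs_pw1 L T e HT He). pose proof (Vs_Derive_pw1 L T e HT He).
  pose proof (Vs_inv_pw1 L T e HT He Hpos).
  assert (D : forall z, mdet (Fmat e z) = e (fst z)) by (intro; unfold mdet; simpl; ring).
  repeat split; unfold minv.
  (* The determinant of [Fmat] is [e]. The congruence is required at every [z], while positivity is
     assumed on [[0,L]], so [/ e * e] is left uncancelled. *)
  - apply pw2_congr with (fun z => m11 (A z) * (/ e (fst z) * e (fst z)) -
        m12 (A z) * (/ e (fst z) * (snd z * Derive e (fst z))));
      [pw | intro; rewrite D; simpl; ring].
  - apply pw2_congr with (fun z => m12 (A z) * / e (fst z));
      [pw | intro; rewrite D; simpl; ring].
  - apply pw2_congr with (fun z => m21 (A z) * (/ e (fst z) * e (fst z)) -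
        m22 (A z) * (/ e (fst z) * (snd z * Derive e (fst z))));
      [pw | intro; rewrite D; simpl; ring].
  - apply pw2_congr with (fun z => m22 (A z) * / e (fst z));
      [pw | intro; rewrite D; simpl; ring].
Qed.

(** Restricted to strips because [Derive] is linear only on differentiable functions, and a broken
    line may fail to be one at a node. *)
Lemma Derive_difference_quotient (L : R) (T : list tri) (tau : R) (e e' xi : R -> R) :
  triangulation L T -> Vs L T e -> Vs L T e' ->
  (forall t, xi t = (e' t - e t) / tau) ->
  forall a b, strip L (abscissae T) a b -> forall t, a < t < b ->
  Derive xi t = (Derive e' t - Derive e t) / tau.
Proof.
  intros HT He He' E a b Hs t Ht.
  destruct (Vs_is_derive L T e a b HT He Hs) as [d Hd].
  destruct (Vs_is_derive L T e' a b HT He' Hs) as [d' Hd'].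
  rewrite (Derive_ext _ (fun t => / tau * (e' t - e t))) by (intro; rewrite E; unfold Rdiv; ring).
  rewrite Derive_scal, Derive_minus by (eexists; eauto). unfold Rdiv; ring.
Qed.

Lemma intS_comm (L : R) (f g : R -> R) :
  intS L (fun t => f t * g t) = intS L (fun t => g t * f t).
Proof. apply RInt_ext; intros; apply Rmult_comm. Qed.

(** The defining identity turns each pairing with [lap] into a pairing of derivatives, which is
    linear off the nodes. *)
Lemma dlap_difference_quotient (L : R) (T : list tri) (tau : R)
  (lap : (R -> R) -> R -> R) (e e' xi psi : R -> R) :
  0 < L -> triangulation L T -> is_dlap L T lap ->
  Vs L T e -> Vs L T e' -> Vs L T xi -> Vs L T psi ->
  (forall t, xi t = (e' t - e t) / tau) ->
  intS L (fun t => lap xi t * psi t) =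
  (intS L (fun t => lap e' t * psi t) - intS L (fun t => lap e t * psi t)) / tau.
Proof.
  intros HL HT Hlap He He' Hxi Hpsi E.
  rewrite (proj2 (Hlap xi Hxi) psi Hpsi), (proj2 (Hlap e He) psi Hpsi),
    (proj2 (Hlap e' He') psi Hpsi).
  pose proof (Vs_Derive_pw1 L T e HT He). pose proof (Vs_Derive_pw1 L T e' HT He').
  pose proof (Vs_Derive_pw1 L T psi HT Hpsi).
  rewrite (intS_ext L (abscissae T) HL _
    (fun t => / tau * (Derive e' t * Derive psi t) + - / tau * (Derive e t * Derive psi t))).
  - rewrite (intS_plus L (abscissae T)), !(intS_scal L (abscissae T)) by (auto; pw).
    unfold Rdiv; ring.
  - pw.
  - intros a b Hs t Ht.
    rewrite (Derive_difference_quotient L T tau e e' xi HT He He' E a b Hs t Ht).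
    unfold Rdiv; ring.
Qed.

(** * The energy balance of one time step *)

(** The antisymmetric part of [A] is orthogonal to [msym A], and pairing with [mI] gives the
    trace. *)
Lemma frob_stress (mu q : R) (A : mat2) :
  frob (msub (mscal (2 * mu) (msym A)) (mscal q mI)) A =
  2 * mu * frob (msym A) (msym A) - q * (m11 A + m22 A).
Proof.
  destruct A; unfold frob, msub, msym, madd, mtr, mscal, mI; simpl. field.
Qed.

Lemma trace_pullback (A : mat2) (e : R -> R) (z : pt) :
  e (fst z) <> 0 ->
  frob A (Mmat e z) =
  e (fst z) * (m11 (mmul A (minv (Fmat e z))) + m22 (mmul A (minv (Fmat e z)))).
Proof.
  destruct A; intro; unfold frob, mmul, minv, mdet, mscal, Mmat, Fmat; simpl.
  field. lra.
Qed.

Section Step.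
Variables (L : R) (T : list tri) (tau : R).
Hypotheses (L_pos : 0 < L) (tau_pos : 0 < tau) (HT : triangulation L T).

(** The [2 u0] in the extrapolated velocity cancels the mixed term weighted by [e1] and leaves
    [- e0 u0.u1]; this is why the dissipation carries the old height [e0]. *)
Lemma kinetic_balance (e0 e1 : R -> R) (u0 u1 : pt -> pt) :
  Vs L T e0 -> Vs L T e1 -> Vf L T u0 -> Vf L T u1 ->
  intO L (fun x => dot (vscal (/ tau) (vsub (u1 x) (u0 x))) (u1 x) * e1 (fst x))
  + / 2 * intO L (fun x => (e1 (fst x) - e0 (fst x)) / tau *
                    dot (vsub (vscal 2 (u0 x)) (u1 x)) (u1 x))
  = / (2 * tau) * intO L (fun x => e1 (fst x) * dot (u1 x) (u1 x))
    + - / (2 * tau) * intO L (fun x => e0 (fst x) * dot (u0 x) (u0 x))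
    + tau / 2 * intO L (fun x => e0 (fst x) *
                  dot (vscal (/ tau) (vsub (u1 x) (u0 x))) (vscal (/ tau) (vsub (u1 x) (u0 x)))).
Proof.
  intros He0 He1 Hu0 Hu1.
  pose proof (Vs_pw1 L T e0 HT He0). pose proof (Vs_pw1 L T e1 HT He1).
  pose proof (pw2v_Vf L T u0 HT Hu0) as P0. pose proof (pw2v_Vf L T u1 HT Hu1) as P1.
  pose proof (pw2v_vscal _ _ (/ tau) _ (pw2v_vsub _ _ _ _ P1 P0)) as PD.
  pose proof (pw2v_vsub _ _ _ _ (pw2v_vscal _ _ 2 _ P0) P1) as PS.
  pose proof (pw2_dot _ _ _ _ PD P1). pose proof (pw2_dot _ _ _ _ PS P1).
  pose proof (pw2_dot _ _ _ _ P1 P1). pose proof (pw2_dot _ _ _ _ P0 P0).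
  pose proof (pw2_dot _ _ _ _ PD PD).
  rewrite <- !(intO_scal L (abscissae T) L_pos) by pw.
  rewrite <- !(intO_plus L (abscissae T) L_pos) by pw.
  apply intO_ext; auto. intros x y _ _.
  unfold dot, vscal, vsub; simpl. field. lra.
Qed.

Lemma stress_power (mu : R) (e : R -> R) (w : pt -> pt) (q : pt -> R) :
  Vs L T e -> (forall t, 0 <= t <= L -> 0 < e t) -> Vf L T w -> Qf L T q ->
  intO L (fun x => q x * frob (grad w x) (Mmat e x)) = 0 ->
  let G := fun x => mmul (grad w x) (minv (Fmat e x)) in
  intO L (fun x => frob (msub (mscal (2 * mu) (msym (G x))) (mscal (q x) mI)) (G x) * e (fst x))
  = 2 * mu * intO L (fun x => e (fst x) * frob (msym (G x)) (msym (G x))).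
Proof.
  intros He Hpos Hw Hq Hdiv G.
  pose proof (Vs_pw1 L T e HT He).
  pose proof (pw2m_grad L T w HT Hw) as Pg.
  pose proof (pw2m_mul_minv_Fmat L T e _ HT He Hpos Pg) as PG.
  pose proof (pw2m_msym _ _ _ PG) as PS.
  pose proof (pw2_frob _ _ _ _ PS PS) as PSS.
  pose proof (pw2_frob _ _ _ _ Pg (pw2m_Mmat L T e HT He)).
  pose proof (mini_pw2 L T q HT (Qf_mini L T q Hq)).
  fold G in PSS.
  (* The second integral is zero by [Hdiv]; adding it makes the integrands agree pointwise, the
     pressure being matched through [trace_pullback]. *)
  transitivity (2 * mu * intO L (fun x => e (fst x) * frob (msym (G x)) (msym (G x)))
                + -1 * intO L (fun x => q x * frob (grad w x) (Mmat e x)));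
    [|rewrite Hdiv; ring].
  rewrite <- !(intO_scal L (abscissae T) L_pos) by pw.
  rewrite <- !(intO_plus L (abscissae T) L_pos) by pw.
  apply intO_ext; auto. intros x y Hx _.
  assert (e x <> 0) by (pose proof (Hpos x); lra).
  rewrite frob_stress, trace_pullback by auto. unfold G; simpl fst. ring.
Qed.

(** Pointwise, [(a - b) a = (a^2 - b^2 + (a - b)^2) / 2]. *)
Lemma inertia_balance (x0 x1 : R -> R) :
  Vs L T x0 -> Vs L T x1 ->
  intS L (fun t => (x1 t - x0 t) / tau * x1 t)
  = / (2 * tau) * intS L (fun t => x1 t ^ 2) + - / (2 * tau) * intS L (fun t => x0 t ^ 2)
    + tau / 2 * intS L (fun t => ((x1 t - x0 t) / tau) ^ 2).
Proof.
  intros H0 H1. pose proof (Vs_pw1 L T x0 HT H0). pose proof (Vs_pw1 L T x1 HT H1).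
  (* Squares become products, a form that [pw] can traverse. *)
  simpl pow.
  rewrite <- !(intS_scal L (abscissae T) L_pos) by pw.
  rewrite <- !(intS_plus L (abscissae T) L_pos) by pw.
  apply (intS_ext L (abscissae T) L_pos); [pw|].
  intros a b _ t _. field. lra.
Qed.

Lemma stretching_balance (e e' xi : R -> R) :
  Vs L T e -> Vs L T e' -> Vs L T xi -> (forall t, xi t = (e' t - e t) / tau) ->
  intS L (fun t => Derive e' t * Derive xi t)
  = / (2 * tau) * intS L (fun t => Derive e' t ^ 2)
    + - / (2 * tau) * intS L (fun t => Derive e t ^ 2)
    + tau / 2 * intS L (fun t => Derive xi t ^ 2).
Proof.
  intros He He' Hxi E. pose proof (Vs_Derive_pw1 L T e HT He).
  pose proof (Vs_Derive_pw1 L T e' HT He'). pose proof (Vs_Derive_pw1 L T xi HT Hxi).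
  simpl pow.
  rewrite <- !(intS_scal L (abscissae T) L_pos) by pw.
  rewrite <- !(intS_plus L (abscissae T) L_pos) by pw.
  apply (intS_ext L (abscissae T) L_pos); [pw|].
  intros a b Hs t Ht.
  rewrite (Derive_difference_quotient L T tau e e' xi HT He He' E a b Hs t Ht). field. lra.
Qed.

(* Linearity of [lap] is available only after integration against elements of [Vs]. *)
Lemma bending_balance (lap : (R -> R) -> R -> R) (e e' xi : R -> R) :
  is_dlap L T lap ->
  Vs L T e -> Vs L T e' -> Vs L T xi -> (forall t, xi t = (e' t - e t) / tau) ->
  intS L (fun t => Derive (fun s => - lap e' s) t * Derive xi t)
  = / (2 * tau) * intS L (fun t => lap e' t ^ 2)
    + - / (2 * tau) * intS L (fun t => lap e t ^ 2)
    + tau / 2 * intS L (fun t => lap xi t ^ 2).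
Proof.
  intros Hlap He He' Hxi E.
  destruct (Hlap e He) as [Vl _], (Hlap e' He') as [Vl' _], (Hlap xi Hxi) as [Vx Dx].
  pose proof (Vs_Derive_pw1 L T _ HT Hxi). pose proof (Vs_Derive_pw1 L T _ HT Vl').
  assert (SQ : forall f : R -> R, intS L (fun t => f t ^ 2) = intS L (fun t => f t * f t)).
  { intro f; apply RInt_ext; intros; simpl; ring. }
  rewrite !SQ.
  (* The identity for [lap xi] is tested with [lap e'], itself an element of [Vs]; its sign cancels
     the one in [zeta]. *)
  transitivity (intS L (fun t => lap xi t * lap e' t)).
  - rewrite (Dx _ Vl').
    replace (- intS L (fun t => Derive xi t * Derive (lap e') t))
      with (-1 * intS L (fun t => Derive xi t * Derive (lap e') t)) by ring.
    rewrite <- (intS_scal L (abscissae T) L_pos) by pw.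
    apply RInt_ext; intros. rewrite Derive_opp. simpl; ring.
  - assert (Q : forall psi, Vs L T psi -> intS L (fun t => lap xi t * psi t) =
      (intS L (fun t => lap e' t * psi t) - intS L (fun t => lap e t * psi t)) / tau).
    { intros psi Hpsi. apply (dlap_difference_quotient L T); auto. }
    (* Testing with [lap xi], [lap e'] and [lap e] reduces everything to pairings of [lap e'] and
       [lap e], where the square expansion is algebra. *)
    rewrite (Q _ Vx), (intS_comm L (lap e') (lap xi)), (intS_comm L (lap e) (lap xi)).
    rewrite (Q _ Vl'), (Q _ Vl), (intS_comm L (lap e') (lap e)). field. lra.
Qed.

Lemma a_s_expand (g1 g2 g3 : R) (e z xi psi : R -> R) :
  pw1 L (abscissae T) (Derive e) -> pw1 L (abscissae T) (Derive z) ->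
  pw1 L (abscissae T) (Derive xi) -> pw1 L (abscissae T) (Derive psi) ->
  a_s L g1 g2 g3 e z xi psi =
  g1 * intS L (fun t => Derive e t * Derive psi t)
  + g2 * intS L (fun t => Derive z t * Derive psi t)
  + g3 * intS L (fun t => Derive xi t * Derive psi t).
Proof.
  intros. rewrite <- !(intS_scal L (abscissae T) L_pos) by pw.
  rewrite <- !(intS_plus L (abscissae T) L_pos) by pw.
  apply RInt_ext; intros; simpl; ring.
Qed.

End Step.

(** For [phi = u] the two halves of the skew-symmetric convection coincide. The integrand is
    identically zero, so its integral is that of a constant. *)
Lemma intO_convection_self (L : R) (w : pt -> pt) (B : pt -> pt) (e : R -> R) :
  intO L (fun x => (dot (w x) (B x) - dot (w x) (B x)) * e (fst x)) = 0.
Proof.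
  unfold intO. rewrite (RInt_ext _ (fun _ => 0)).
  - rewrite RInt_const. unfold scal; simpl; unfold mult; simpl; ring.
  - intros x _. rewrite (RInt_ext _ (fun _ => 0)).
    + rewrite RInt_const. unfold scal; simpl; unfold mult; simpl; ring.
    + intros y _; simpl; ring.
Qed.

(** Index 1 comes from the explicit start [eta 0 + tau * xi 0]; every later height is an unknown of
    the preceding step. *)
Lemma Vs_eta (L : R) (T : list tri) (tau rf rs mu g1 g2 g3 : R)
  (lap : (R -> R) -> (R -> R)) (N : nat)
  (p : nat -> pt -> R) (u : nat -> pt -> pt) (xi eta : nat -> R -> R) :
  SchemeR_solution L T tau rf rs mu g1 g2 g3 lap N p u xi eta ->
  forall k, (k <= N + 1)%nat -> Vs L T (eta k).
Proof.
  intros [_ [Hx0 [He0 [E1 H]]]] [|[|k]] Hk; auto.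
  - destruct Hx0 as [Px Ax], He0 as [Pe Ae]. split.
    + intro t; rewrite !E1, Px, Pe; reflexivity.
    + intros K KT a b Ha Hb Hab.
      destruct (Ax K KT a b Ha Hb Hab) as [c [d F]], (Ae K KT a b Ha Hb Hab) as [c' [d' F']].
      exists (c' + tau * c), (d' + tau * d). intros t Ht.
      rewrite E1, F, F' by auto. ring.
  - replace (S (S k)) with (S k + 1)%nat by lia. apply H; lia.
Qed.

Lemma energy_step (L : R) (T : list tri) (tau rf rs mu g1 g2 g3 : R)
  (lap : (R -> R) -> (R -> R)) (N : nat)
  (p : nat -> pt -> R) (u : nat -> pt -> pt) (xi eta : nat -> R -> R) (j : nat) :
  0 < L -> 0 < tau -> triangulation L T -> is_dlap L T lap ->
  SchemeR_solution L T tau rf rs mu g1 g2 g3 lap N p u xi eta ->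
  (forall k, (k <= N + 1)%nat -> forall t, 0 <= t <= L -> 0 < eta k t) ->
  (S j <= N)%nat ->
  Energy L rf rs g1 g2 lap u xi eta (S j)
  + tau * (2 * mu * intO L (fun x => eta (S j) (fst x) *
                   frob (msym (Gk eta u (S j) x)) (msym (Gk eta u (S j) x)))
        + g3 * intS L (fun t => (Derive (xi (S j)) t) ^ 2)
        + Dnum L tau rf rs g1 g2 lap u xi eta (S j))
  = Energy L rf rs g1 g2 lap u xi eta j.
Proof.
  intros HL Htau HT Hlap Hsol Hpos Hj.
  pose proof (Vs_eta L T tau rf rs mu g1 g2 g3 lap N p u xi eta Hsol) as Veta.
  destruct Hsol as [Hu0 [Hx0 [He0 [E1 H]]]].
  assert (Uj : Vf L T (u j)) by (destruct j; [auto | apply H; lia]).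
  assert (Xj : Vs L T (xi j)) by (destruct j; [auto | apply H; lia]).
  assert (Ej : Vs L T (eta j)) by (apply Veta; lia).
  destruct (H (S j)) as [Hp [Hu [Hxi [He' [Htr [Hquot [HR1 HR2]]]]]]]; [lia|].
  assert (He : Vs L T (eta (S j))) by (apply Veta; lia).
  assert (Hpos' : forall t, 0 <= t <= L -> 0 < eta (S j) t) by (apply Hpos; lia).
  (* The pair is an admissible test function: [Htr] is exactly the required trace condition. *)
  specialize (HR2 (u (S j)) (xi (S j)) Hu Hxi Htr).
  unfold R2_lhs in HR2. cbv zeta in HR2. unfold Energy, Dnum.
  (* Writing the step as [S j] keeps the truncated subtraction harmless. *)
  replace (S j - 1)%nat with j in * by lia.
  replace (j + 1)%nat with (S j) by lia.
  destruct (Hlap _ He') as [Vl' _].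
  rewrite (a_s_expand L T HL) in HR2; try (apply Vs_Derive_pw1; solve [auto]).
  2: { apply pw1_congr with (fun t => -1 * Derive (lap (eta (S j + 1)%nat)) t).
       - apply pw1_mult; [apply pw1_const | apply Vs_Derive_pw1; auto].
       - intro; rewrite Derive_opp; ring. }
  pose proof (kinetic_balance L T tau HL Htau HT _ _ _ _ Ej He Uj Hu) as BK.
  pose proof (stress_power L T HL HT mu _ _ _ He Hpos' Hu Hp (HR1 _ Hp)) as BS.
  pose proof (inertia_balance L T tau HL Htau HT _ _ Xj Hxi) as BI.
  pose proof (stretching_balance L T tau HL Htau HT _ _ _ He He' Hxi Hquot) as BE.
  pose proof (bending_balance L T tau HL Htau HT _ _ _ _ Hlap He He' Hxi Hquot) as BB.
  pose proof (intO_convection_self L (u (S j))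
    (fun x => mv (Gk eta u (S j) x)
       (vsub (u j x) (0, snd x * ((eta (S j) (fst x) - eta j (fst x)) / tau)))) (eta (S j))) as BC.
  cbv zeta in BS. unfold Gk in *.
  rewrite BC, BS, BI, BE, BB in HR2.
  assert (SQ : intS L (fun t => Derive (xi (S j)) t * Derive (xi (S j)) t) =
               intS L (fun t => Derive (xi (S j)) t ^ 2)).
  { apply RInt_ext; intros; simpl; ring. }
  rewrite SQ in HR2.
  (* The two kinetic terms come first in the left-nested sum, so [BK] scaled by [rf] replaces both
     at once. *)
  match type of BK with ?a + / 2 * ?b = ?c =>
    assert (HK : rf * a + / 2 * rf * b = rf * c) by (rewrite <- BK; ring);
    rewrite HK in HR2 end.
  (* The difference of the two sides is [tau] times the tested momentum equation. *)
  match goal with |- ?l = ?r => assert (l - r = 0); [|lra] end.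
  rewrite <- (Rmult_0_r tau), <- HR2. field. lra.
Qed.

Theorem mainTheorem5
  (L1 : R) (T : list tri) (tau rf rs mu g1 g2 g3 : R) (N : nat)
  (lap : (R -> R) -> (R -> R))
  (p : nat -> pt -> R) (u : nat -> pt -> pt) (xi eta : nat -> R -> R) :
  0 < L1 -> 0 < tau -> 0 < rf -> 0 < rs -> 0 < mu -> 0 < g1 -> 0 < g2 -> 0 <= g3 ->
  triangulation L1 T ->
  is_dlap L1 T lap ->
  SchemeR_solution L1 T tau rf rs mu g1 g2 g3 lap N p u xi eta ->
  (forall k, (k <= N + 1)%nat -> forall t, 0 <= t <= L1 -> 0 < eta k t) ->
  forall m, (1 <= m <= N)%nat ->
    Energy L1 rf rs g1 g2 lap u xi eta m
    + tau * sumR (fun k =>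
        2 * mu * intO L1 (fun x => eta k (fst x) *
                   frob (msym (Gk eta u k x)) (msym (Gk eta u k x)))
        + g3 * intS L1 (fun t => (Derive (xi k) t) ^ 2)
        + Dnum L1 tau rf rs g1 g2 lap u xi eta k) m
    = Energy L1 rf rs g1 g2 lap u xi eta 0.
Proof.
  intros HL Htau _ _ _ _ _ _ HT Hlap Hsol Hpos m [_ Hm].
  (* The base case is the empty sum; each successor telescopes one more [energy_step]. *)
  induction m as [|m IH].
  - simpl; ring.
  - rewrite <- IH by lia.
    rewrite <- (energy_step L1 T tau rf rs mu g1 g2 g3 lap N p u xi eta m) by auto.
    unfold sumR at 1; fold sumR. ring.
Qed.
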